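(* Let $A,B\in M_n(\mathbf{k})$ satisfy $AB=-BAB$. Then there is an invertible matrix $P\in M_n(\mathbf{k})$ such that $$A=P^{-1}\begin{bmatrix} X_{11} & X_{12} & \cdots & X_{1l} \\ X_{21} & X_{22} & \cdots & X_{2l} \\ \vdots & \vdots & \ddots & \vdots \\ X_{l1} & X_{l2} & \cdots & X_{ll} \end{bmatrix}P,\qquad B=P^{-1}\begin{bmatrix} J_{p_1}(b_1) & 0 & \cdots & 0 \\ 0 & J_{p_2}(b_2) & \cdots & 0 \\ \vdots & \vdots & \ddots & \vdots \\ 0 & 0 & \cdots & J_{p_l}(b_l) \end{bmatrix}P,$$ where $b_i\in\mathbf{k}$, $p_i\in\mathbb{N}\setminus\{0\}$ and $X_{ij}\in\mathbf{k}^{p_i\times p_j}$ are such that $$X_{ij}J_{p_j}(b_j)=-J_{p_i}(b_i)X_{ij}J_{p_j}(b_j)$$ for all $i,j=1,\dots,l$. Thus each $X_{ij}$ is determined as follows: if $(b_i,b_j)=(-1,0)$, all entries of $X_{ij}$ outside its first row and last column are $0$; if $b_i=-1$ and $b_j\ne0$, all entries outside its first row are $0$; if $b_i\neq-1$ and $b_j=0$, all entries outside its last column are $0$; if $b_i\ne-1$ and $b_j\neq0$, then $X_{ij}=0$.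
   Context: $\mathbf{k}$ is an algebraically closed field of characteristic zero; $\mathbb{N}$ denotes the nonnegative integers. $J_k(b)$ denotes the $k\times k$ upper triangular Jordan block with $b$ on the diagonal, $1$ on the superdiagonal and $0$ elsewhere. *)

(* Defs.v *)
From mathcomp Require Import all_boot all_order all_algebra.
Set Implicit Arguments.
Unset Strict Implicit.
Unset Printing Implicit Defensive.
Import GRing.Theory.
Local Open Scope ring_scope.

Definition Jordan_block (k : fieldType) (m : nat) (b : k) : 'M[k]_m :=
  \matrix_(r < m, c < m)
    (if c == r :> nat then b else if c == r.+1 :> nat then 1 else 0).

(* Rows and columns are numbered from 0: the first row is [r = 0] and the last
   column is the [c] with [c.+1 = q]. *)
Definition zero_outside_first_row (k : fieldType) (m q : nat)
    (X : 'M[k]_(m, q)) : Prop :=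
  forall (r : 'I_m) (c : 'I_q), r != 0%N :> nat -> X r c = 0.

Definition zero_outside_last_col (k : fieldType) (m q : nat)
    (X : 'M[k]_(m, q)) : Prop :=
  forall (r : 'I_m) (c : 'I_q), c.+1 != q -> X r c = 0.

Definition zero_outside_first_row_last_col (k : fieldType) (m q : nat)
    (X : 'M[k]_(m, q)) : Prop :=
  forall (r : 'I_m) (c : 'I_q), r != 0%N :> nat -> c.+1 != q -> X r c = 0.

(* Main.v *)
(* The Jordan form of B is obtained by splitting off one block at a time.  Let a
   be a root of the minimal polynomial of B, of multiplicity p, and N = B - a.
   There are a row v and a column w with v N^p = 0, N^p w = 0 and
   v N^(p-1) w <> 0: writing the minimal polynomial as (X - a)^p q, they are a row
   and a column of q(B), because N^(p-1) q(B)^2 <> 0.  Then the rows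
   v N^i form a Jordan chain, and the common kernel of the columns N^j w is a
   B-stable complement of their span.

   Once B is in Jordan form, A B = - B A B reads
   (1 + J_i) X_ij J_j = 0 on blocks.  A Jordan block with nonzero eigenvalue can
   be cancelled, while a nilpotent one shifts the rows up when it acts on the
   left, and the columns to the right when it acts on the right. *)
Require Import Defs.
From mathcomp Require Import all_boot all_order all_algebra.
From mathcomp Require Import zify.
Import GRing.Theory.
Local Open Scope ring_scope.

Set Implicit Arguments.
Unset Strict Implicit.
Unset Printing Implicit Defensive.

Lemma Jordan_blockE (k : fieldType) (m : nat) (b : k) :
  Jordan_block m b = b%:M + Jordan_block m 0.
Proof.
apply/matrixP=> r c; rewrite !mxE -val_eqE /= eq_sym.
by case: eqP => _; rewrite ?addr0 ?add0r.
Qed.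

(** The sum has at most one term; the last row, which has no successor, needs no separate case
    because its sum is empty. *)
Lemma mul_Jordan0E (k : fieldType) (m q : nat) (Y : 'M[k]_(m, q)) r c :
  (Jordan_block m 0 *m Y) r c = \sum_(s < m | s == r.+1 :> nat) Y s c.
Proof.
rewrite mxE [RHS]big_mkcond; apply: eq_bigr => s _; rewrite mxE.
have [->|_] := eqVneq (s : nat) r; first by rewrite ltn_eqF // mul0r.
by case: eqP; rewrite ?mul1r ?mul0r.
Qed.

Lemma mulmx_Jordan0E (k : fieldType) (m q : nat) (Y : 'M[k]_(q, m)) r c :
  (Y *m Jordan_block m 0) r c = \sum_(s < m | s.+1 == c) Y r s.
Proof.
rewrite mxE [RHS]big_mkcond; apply: eq_bigr => s _; rewrite mxE eq_sym.
have [->|_] := eqVneq (s : nat) c; first by rewrite gtn_eqF // mulr0.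
by rewrite eq_sym; case: eqP; rewrite ?mulr1 ?mulr0.
Qed.

Lemma Jordan_block_unit (k : fieldType) (m : nat) (b : k) :
  b != 0 -> Jordan_block m b \in unitmx.
Proof.
move=> b0; rewrite -unitmx_tr unitmxE det_trig.
  by rewrite unitfE; apply/prodf_neq0 => i _; rewrite !mxE eqxx.
apply/is_trig_mxP => i j ij; rewrite !mxE.
by rewrite (ltn_eqF ij) ltn_eqF // ltnW.
Qed.

Lemma col_mulmx (R : pzSemiRingType) (m n p : nat) (j : 'I_p)
    (A : 'M[R]_(m, n)) (B : 'M[R]_(n, p)) : col j (A *m B) = A *m col j B.
Proof. by rewrite !colE mulmxA. Qed.

Lemma mul_row_colE (R : pzSemiRingType) (m n p : nat) (A : 'M[R]_(m, n))
    (B : 'M[R]_(n, p)) i j : (row i A *m col j B) 0 0 = (A *m B) i j.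
Proof. by rewrite !mxE; apply: eq_bigr => l _; rewrite !mxE. Qed.

Lemma root_minpoly_vectors (k : closedFieldType) (n : nat) (B : 'M[k]_n.+1) :
  exists (a : k) (p : nat) (v : 'rV[k]_n.+1) (w : 'cV[k]_n.+1),
    let N := B - a%:M in
    [/\ v *m N ^+ p.+1 = 0, N ^+ p.+1 *m w = 0
      & (v *m N ^+ p *m w) 0 0 != 0].
Proof.
have [a ra] : exists a, root (mxminpoly B) a.
  by apply/closed_rootP; rewrite size_mxminpoly eqSS -lt0n mxminpoly_nonconstant.
have m0 : mxminpoly B != 0 by rewrite monic_neq0 ?mxminpoly_monic.
have [m [q /implyP/(_ m0) rqa def_m]] := multiplicity_XsubC (mxminpoly B) a.
case: m => [|p] in def_m.
  by move: ra rqa; rewrite def_m expr0 mulr1 => ->.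
have horN : horner_mx B ('X - a%:P) = B - a%:M.
  by rewrite rmorphB /= horner_mx_X horner_mx_C.
set N := B - a%:M in horN *; set Q := horner_mx B q.
have QN : Q *m N ^+ p.+1 = 0.
  by rewrite -(mx_root_minpoly B) def_m rmorphM rmorphXn /= horN.
have NQ : N ^+ p.+1 *m Q = 0.
  by rewrite -QN /Q -horN -rmorphXn /=; apply: comm_horner_mx2.
have [i [j nz]] : exists i j, (Q *m N ^+ p *m Q) i j != 0.
  (* Otherwise the minimal polynomial [q * ('X - a%:P) ^+ p.+1] divides [q * ('X - a%:P) ^+ p * q];
     cancelling leaves ['X - a%:P] dividing [q], against the choice of [q]. *)
  apply/matrix0Pn; apply: contraNneq rqa => QNQ0.
  have : mxminpoly B %| q * ('X - a%:P) ^+ p * q.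
    by apply: mxminpoly_min; rewrite !rmorphM rmorphXn /= horN.
  rewrite def_m exprSr mulrA dvdp_mul2l ?dvdp_XsubCl //.
  by move: m0; rewrite def_m exprSr mulrA mulf_eq0 => /norP[].
exists a, p, (row i Q), (col j Q); split; rewrite -/N.
- by rewrite -row_mul QN row0.
- by rewrite -col_mulmx NQ col0.
- by rewrite -row_mul mul_row_colE.
Qed.

(* The dual Jordan chains [v N^i] (rows) and [N^j w] (columns, in reverse order)
   pair to an upper triangular Toeplitz matrix with diagonal [v N^(p-1) w]. *)
Lemma dual_Jordan_chains (k : closedFieldType) (n : nat) (B : 'M[k]_n.+1) :
  exists (p : nat) (a : k) (M : 'M[k]_(p, n.+1)) (C : 'M[k]_(n.+1, p)),
    [/\ (0 < p)%N, M *m B = Jordan_block p a *m M,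
        B *m C = C *m Jordan_block p a & M *m C \in unitmx].
Proof.
have [a [p [v [w [vN Nw nz]]]]] := root_minpoly_vectors B.
set N := B - a%:M in vN Nw nz.
have defB : B = a%:M + N by rewrite addrC subrK.
pose M := \matrix_(i < p.+1, c < n.+1) (v *m N ^+ i) 0 c.
pose C := \matrix_(r < n.+1, j < p.+1) (N ^+ (p - j) *m w) r 0.
have rowM i : row i M = v *m N ^+ i by apply/rowP=> c; rewrite !mxE.
have colC j : col j C = N ^+ (p - j) *m w.
  by apply/colP=> r; rewrite !mxE.
exists p.+1, a, M, C; split=> //.
- rewrite Jordan_blockE defB mulmxDr mulmxDl scalar_mxC; congr (_ + _).
  apply/matrixP=> r c; rewrite mul_Jordan0E.
  under eq_bigr do rewrite mxE.
  rewrite (big_ord1_eq _ (fun i => (v *m N ^+ i) 0 c)).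
  have -> : (M *m N) r c = (row r M *m N) 0 c by rewrite -row_mul [RHS]mxE.
  rewrite rowM -mulmxA -[_ *m N]exprSr; case: ltnP => // pr.
  have -> : r.+1 = p.+1 by apply/eqP; rewrite eqn_leq ltn_ord.
  by rewrite vN mxE.
- rewrite Jordan_blockE defB mulmxDr mulmxDl -scalar_mxC; congr (_ + _).
  apply/matrixP=> r c; rewrite mulmx_Jordan0E.
  have -> : (N *m C) r c = (N *m col c C) r 0 by rewrite -col_mulmx [RHS]mxE.
  under eq_bigr do rewrite mxE.
  rewrite colC mulmxA -[N *m _]exprS; case: c => -[|c] ltc /=.
    by rewrite subn0 Nw mxE big_pred0.
  under eq_bigl do rewrite eqSS.
  rewrite (big_ord1_eq _ (fun i => (N ^+ (p - i) *m w) r 0)) ltnW //.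
  by rewrite subnSK.
have MCE i j : (M *m C) i j = (v *m N ^+ (i + (p - j)) *m w) 0 0.
  by rewrite -mul_row_colE rowM colC exprD !mulmxA.
rewrite -unitmx_tr unitmxE det_trig.
  rewrite unitfE; apply/prodf_neq0 => i _.
  by rewrite mxE MCE subnKC // -ltnS.
apply/is_trig_mxP => i j ij; rewrite mxE MCE.
(* Strictly below the diagonal of [M *m C] the exponent exceeds [p], so the power of [N] kills
   [v]. *)
have -> : (j + (p - i) = p.+1 + (j - i.+1))%N.
  by have := ltn_ord i; have := ltn_ord j; lia.
by rewrite exprD mulmxA vN !mul0mx mxE.
Qed.

(* [chain_cols] is unconstrained here: it is meant to hold the part of the dual basis
   that corresponds to the chain. *)
Record Jordan_chain (k : fieldType) (n : nat) (B : 'M[k]_n) := JordanChain {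
  chain_len : nat;
  chain_eig : k;
  chain_rows : 'M[k]_(chain_len, n);
  chain_cols : 'M[k]_(n, chain_len);
  chain_len_gt0 : (0 < chain_len)%N;
  chain_rowsM :
    chain_rows *m B = Jordan_block chain_len chain_eig *m chain_rows }.

Lemma lift_chain_rowsM (k : fieldType) (n q : nat) (B : 'M[k]_n) (B' : 'M[k]_q)
    (K : 'M[k]_(q, n)) (KB : K *m B = B' *m K) (x : Jordan_chain B') :
  chain_rows x *m K *m B =
    Jordan_block (chain_len x) (chain_eig x) *m (chain_rows x *m K).
Proof. by rewrite -mulmxA KB !mulmxA chain_rowsM. Qed.

(** Here [B'] is to be the matrix of [B] on a stable row space spanned by [K], and [L] takes dual
    columns back to the whole space. *)
Definition lift_chain (k : fieldType) (n q : nat) (B : 'M[k]_n) (B' : 'M[k]_q)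
    (K : 'M[k]_(q, n)) (L : 'M[k]_(n, q)) (KB : K *m B = B' *m K)
    (x : Jordan_chain B') : Jordan_chain B :=
  @JordanChain k n B (chain_len x) (chain_eig x) (chain_rows x *m K)
    (L *m chain_cols x) (chain_len_gt0 x) (lift_chain_rowsM KB x).

(* By equality of dimensions, the second identity says that the rows of the chains
   form a basis and the [chain_cols] the dual basis. *)
Lemma Jordan_basis (k : closedFieldType) (n : nat) (B : 'M[k]_n) :
  exists s : seq (Jordan_chain B),
    (\sum_(x <- s) chain_len x)%N = n /\
    \sum_(x <- s) chain_cols x *m chain_rows x = 1%:M.
Proof.
elim/ltn_ind: n => -[|n] IH in B *.
  by exists [::]; rewrite !big_nil; split=> //; apply/matrixP=> -[].
have [p [a [M [C [p0 MB BC MCu]]]]] := dual_Jordan_chains B.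
have rC : \rank C = p.
  apply/eqP; rewrite eqn_leq rank_leq_col /=.
  by rewrite -{1}(mxrank_unit MCu) mxrankM_maxr.
have pn : (p <= n.+1)%N by rewrite -rC rank_leq_row.
have rK : \rank (kermx C) = (n.+1 - p)%N by rewrite mxrank_ker rC.
pose K := row_base (kermx C).
have subK m (Y : 'M_(m, n.+1)) : (Y <= K)%MS = (Y *m C == 0).
  by rewrite /K eq_row_base; apply/sub_kermxP/eqP.
have KC : K *m C = 0 by apply/eqP; rewrite -subK.
have /submxP[B' KB] : (K *m B <= K)%MS.
  by rewrite subK -mulmxA BC mulmxA KC mul0mx.
(* Normalized so that [M *m D = 1%:M]: then [D *m M] projects rows onto the span of the chain along
   the kernel of [C], and [L] gives the coordinates of the complementary projection in the basis
   [K]. *)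
pose D := C *m invmx (M *m C).
have /submxP[L LK] : (1%:M - D *m M <= K)%MS.
  by rewrite subK mulmxBl mul1mx -!mulmxA mulVmx // mulmx1 subrr.
have [|s [len_s sum_s]] := IH _ _ B'; first by rewrite rK; lia.
clearbody K.
exists (JordanChain D p0 MB :: map (lift_chain L KB) s).
rewrite !big_cons !big_map /=; split; first by rewrite len_s rK subnKC.
under eq_bigr => x _ do rewrite !mulmxA -[L *m _ *m _]mulmxA.
by rewrite -mulmx_suml -mulmx_sumr sum_s mulmx1 -LK addrC subrK.
Qed.

(** The block sizes add up to [n] only propositionally, so the change of basis is formally
    rectangular. *)
Lemma mulmx1C_eq (k : fieldType) (m n : nat) (P : 'M[k]_(m, n))
    (Q : 'M[k]_(n, m)) : m = n -> Q *m P = 1%:M -> P *m Q = 1%:M.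
Proof. by move=> e; case: n / e in P Q *; exact: mulmx1C. Qed.

Lemma cast_conjmx (k : fieldType) (m n : nat) (e : m = n) (P : 'M[k]_(m, n))
    (Q : 'M[k]_(n, m)) (A : 'M[k]_n) :
  Q *m P = 1%:M ->
  let P' := castmx (e, erefl n) P in
  P' \in unitmx /\ A = invmx P' *m castmx (e, e) (P *m A *m Q) *m P'.
Proof.
case: n / e in P Q A * => QP /=; rewrite !castmx_id.
have [_ Pu] := mulmx1_unit QP; split=> //.
by rewrite -!mulmxA QP mulmx1 mulKmx.
Qed.

Lemma annihilated_pattern (k : fieldType) (m q : nat) (b c : k)
    (X : 'M[k]_(m, q)) :
  X *m Jordan_block q c = - (Jordan_block m b *m X *m Jordan_block q c) ->
  [/\ b = -1 -> c = 0 -> zero_outside_first_row_last_col X,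
      b = -1 -> c <> 0 -> zero_outside_first_row X,
      b <> -1 -> c = 0 -> zero_outside_last_col X
    & b <> -1 -> c <> 0 -> X = 0].
Proof.
move=> /eqP; rewrite -addr_eq0 -mulmxDl => /eqP annX.
(* Adding the identity to a Jordan block shifts its eigenvalue, so the left factor is nilpotent
   exactly when [b = -1]. *)
have {}annX : Jordan_block m (b + 1) *m X *m Jordan_block q c = 0.
  rewrite -annX; congr (_ *m _).
  rewrite [X in X *m _]Jordan_blockE [X in _ + X *m _]Jordan_blockE.
  by rewrite !mulmxDl raddfD /= mulmxDl mul1mx -addrA [X + _]addrC [RHS]addrC addrA.
have right_unit Y : c <> 0 -> Y *m Jordan_block q c = 0 :> 'M_(m, q) -> Y = 0.
  move=> /eqP c0 Y0.
  by rewrite -(mulmxK (Jordan_block_unit q c0) Y) Y0 mul0mx.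
have left_unit Y : b <> -1 -> Jordan_block m (b + 1) *m Y = 0 :> 'M_(m, q) -> Y = 0.
  move=> /eqP; rewrite -addr_eq0 => b1 Y0.
  by rewrite -(mulKmx (Jordan_block_unit m b1) Y) Y0 mulmx0.
have first_row Y : b = -1 -> Jordan_block m (b + 1) *m Y = 0 :> 'M_(m, q) ->
    zero_outside_first_row Y.
  move=> -> /matrixP Y0 r s; case: r => -[|r] ltr // _.
  have := Y0 (Ordinal (ltnW ltr)) s; rewrite addrC subrr mul_Jordan0E mxE /=.
  by rewrite (big_pred1 (Ordinal ltr)).
(* Stated for a single row: when [b = -1] and [c = 0], only the rows of [X *m Jordan_block q c]
   after the first are known to vanish. *)
have last_col (Y : 'M_(m, q)) r (s : 'I_q) : c = 0 ->
    (forall t, (Y *m Jordan_block q c) r t = 0) -> s.+1 != q -> Y r s = 0.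
  move=> -> Y0 sq; have lts : (s.+1 < q)%N by rewrite ltn_neqAle sq ltn_ord.
  have := Y0 (Ordinal lts); rewrite mulmx_Jordan0E.
  by rewrite (big_pred1 s) // => i; rewrite /= eqSS.
split=> [b1 c0 r s r0 sq | b1 c0 | b1 c0 r s sq | b1 c0].
- apply: last_col => // t; apply: first_row => //; by rewrite mulmxA.
- by apply: first_row => //; apply: right_unit.
- apply: last_col => // t; rewrite [_ *m _](left_unit _ b1) ?mxE //.
  by rewrite mulmxA.
- by apply: right_unit => //; apply: left_unit => //; rewrite mulmxA.
Qed.

Theorem theorem3p6 (k : closedFieldType) (hk : [pchar k] =i pred0)
    (n : nat) (A B : 'M[k]_n) (hAB : A *m B = - (B *m A *m B)) :
  exists (P : 'M[k]_n) (l : nat) (p : 'I_l -> nat) (b : 'I_l -> k)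
         (X : forall i j : 'I_l, 'M[k]_(p i, p j))
         (e : (\sum_(i < l) p i)%N = n),
    [/\ P \in unitmx,
        forall i : 'I_l, p i <> 0%N,
        A = invmx P *m castmx (e, e) (\mxblock_(i < l, j < l) X i j) *m P,
        B = invmx P *m castmx (e, e) (\mxdiag_(i < l) Jordan_block (p i) (b i)) *m P
      & forall i j : 'I_l,
          X i j *m Jordan_block (p j) (b j)
            = - (Jordan_block (p i) (b i) *m X i j *m Jordan_block (p j) (b j))
          /\ [/\ b i = -1 -> b j = 0 -> zero_outside_first_row_last_col (X i j),
                 b i = -1 -> b j <> 0 -> zero_outside_first_row (X i j),
                 b i <> -1 -> b j = 0 -> zero_outside_last_col (X i j)
               & b i <> -1 -> b j <> 0 -> X i j = 0]].
Proof.
have [s [len_s sum_s]] := Jordan_basis B.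
pose c i := tnth (in_tuple s) i.
pose p i := chain_len (c i).
pose J := \mxdiag_i Jordan_block (p i) (chain_eig (c i)).
pose P := \mxcol_i (chain_rows (c i) : 'M_(p i, n)).
pose Q := \mxrow_i (chain_cols (c i) : 'M_(n, p i)).
have e : (\sum_i p i)%N = n by rewrite -[RHS]len_s [RHS]big_tnth.
have QP : Q *m P = 1%:M by rewrite mul_mxrow_mxcol -sum_s [RHS]big_tnth.
have PQ := mulmx1C_eq e QP.
have PB : P *m B = J *m P.
  by rewrite mxcol_mul mul_mxdiag_mxcol; apply: eq_mxcol => i; exact: chain_rowsM.
pose X i j := submxblock (P *m A *m Q) i j.
have defR : \mxblock_(i, j) X i j = P *m A *m Q by exact: submxblockK.
have XJ i j : X i j *m Jordan_block (p j) (chain_eig (c j)) =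
    - (Jordan_block (p i) (chain_eig (c i)) *m X i j
       *m Jordan_block (p j) (chain_eig (c j))).
  (* [P] and [Q] are mutually inverse, so [P *m B = J *m P] transfers to [Q]. *)
  have QJ : Q *m J = B *m Q by rewrite -[Q *m J]mulmx1 -PQ mulmxA -(mulmxA Q) -PB mulmxA QP mul1mx.
  (* This is [hAB] in the Jordan basis; its blocks are the required equations. *)
  have : P *m A *m Q *m J = - (J *m (P *m A *m Q) *m J).
    have JP : J *m P *m A = P *m (B *m A) by rewrite -PB mulmxA.
    rewrite !mulmxA JP -!mulmxA QJ !(mulmxA A) {1}hAB.
    by rewrite mulNmx mulmxN !mulmxA.
  rewrite -defR mul_mxdiag_mxblock !mul_mxblock_mxdiag.
  by rewrite -mxblockN => /eq_mxblockP.
have [Pu defA] := cast_conjmx e A QP.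
have [_ defB] := cast_conjmx e B QP.
exists (castmx (e, erefl n) P), (size s), p, (fun i => chain_eig (c i)), X, e; split=> //.
- by move=> i; apply/eqP; rewrite -lt0n chain_len_gt0.
- by rewrite defR.
- rewrite -/J; suff -> : J = P *m B *m Q by [].
  by rewrite PB -mulmxA PQ mulmx1.
- by move=> i j; split; [exact: XJ | exact: annihilated_pattern (XJ i j)].
Qed.
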